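(* Let $\mathcal X$ be a Hilbert space, let $C_0,\alpha,c_1>0$ be constants, and assume that $(\Lambda_n)_{1\le n\le\mathcal N}$ is monotonically increasing. Then: (i) If $d_n\le C_0n^{-\alpha}$ for every $n\ge1$, then for all $\varphi\in F$ and $1\le n\le\mathcal N$, $$\|\varphi-\mathcal J_n[\varphi]\|_{\mathcal X}\le\begin{cases}2C_0(1+\eta^{-1})(1+\Lambda_1),& n=1,\\ C_0\,2^{3\alpha+1}(1+\Lambda_n)^3\,\eta^{-2}\,n^{-\alpha},& n\ge2.\end{cases}$$ (ii) If $C_0\ge1$ and $d_n\le C_0e^{-c_1n^\alpha}$ for every $n\ge1$, then, with $c_2=c_12^{-2\alpha-1}$, for all $\varphi\in F$ and $1\le n\le\mathcal N$, $$\|\varphi-\mathcal J_n[\varphi]\|_{\mathcal X}\le\begin{cases}2C_0(1+\eta^{-1})(1+\Lambda_1),& n=1,\\ C_0\sqrt2\,(1+\Lambda_n)^2\,\eta^{-1}\,e^{-c_2n^\alpha},& n\ge2.\end{cases}$$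
   Context: Setting. $\mathcal X$ is a real Hilbert space of functions defined over a domain $\overline\Omega\subset\mathbb R^d$ or $\mathbb C^d$, with induced norm $\|\cdot\|_{\mathcal X}$ and dual $\mathcal X'$; $F\subset\mathcal X$ is compact with $\|\varphi\|_{\mathcal X}\le 1$ for all $\varphi\in F$; $\mathcal N\in\{1,2,\dots\}\cup\{\infty\}$ is such that $\dim\operatorname{span}F>\mathcal N$ (infinite-dimensional if $\mathcal N=\infty$); indices $n$ are always finite integers. $\Sigma\subset\mathcal X'$ is a dictionary such that: (P1) $\|\sigma\|_{\mathcal X'}=1$ for all $\sigma\in\Sigma$; (P2) if $\varphi\in\operatorname{span}F$ and $\sigma(\varphi)=0$ for all $\sigma\in\Sigma$, then $\varphi=0$; (P3) for all $\varphi\in\operatorname{span}F$ the set $\{\sigma(\varphi):\sigma\in\Sigma\}\subset\mathbb R$ is closed. GEIM weak greedy algorithm. Fix $\eta\in(0,1]$. Let $F_0\subset F_1\subset\cdots$ be subsets of $F$ and $\widetilde\Sigma_0\subset\widetilde\Sigma_1\subset\cdots$ subsets of $\Sigma$ (all finite if $\eta<1$; $F_n=F$ for all $n$ if $\eta=1$) such that $\widetilde\Sigma_n$ satisfies (P2) and (P3) with $F$ replaced by $F_n$. Choose $\varphi_0\in\operatorname{argmax}_{\varphi\in F_0}\|\varphi\|_{\mathcal X}$ and $\sigma_0\in\operatorname{argmax}_{\sigma\in\widetilde\Sigma_0}|\sigma(\varphi_0)|$. For $1\le n\le\mathcal N$ put $X_n=\operatorname{span}\{\varphi_0,\dots,\varphi_{n-1}\}$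 and let $\mathcal J_n:\mathcal X\to X_n$ be the linear operator for which $\mathcal J_n[\varphi]$ is the unique element of $X_n$ with $\sigma_i(\mathcal J_n[\varphi])=\sigma_i(\varphi)$, $i=0,\dots,n-1$ (this is well posed and $\dim X_n=n$); then choose $\varphi_n\in\operatorname{argmax}_{\varphi\in F_n}\|\varphi-\mathcal J_n[\varphi]\|_{\mathcal X}$ and $\sigma_n\in\operatorname{argmax}_{\sigma\in\widetilde\Sigma_n}|\sigma(\varphi_n-\mathcal J_n[\varphi_n])|$. The sets $F_n$ are such that $\max_{F_0}\|\varphi\|_{\mathcal X}\ge\eta\max_F\|\varphi\|_{\mathcal X}$ and $\max_{\varphi\in F_n}\|\varphi-\mathcal J_n[\varphi]\|_{\mathcal X}\ge\eta\max_{\varphi\in F}\|\varphi-\mathcal J_n[\varphi]\|_{\mathcal X}$ for $1\le n\le\mathcal N$. Notation. $\Lambda_n=\sup_{\varphi\in\mathcal X\setminus\{0\}}\|\mathcal J_n[\varphi]\|_{\mathcal X}/\|\varphi\|_{\mathcal X}$ (Lebesgue constant) for $1\le n\le\mathcal N$. The Kolmogorov $n$-width is $d_n=d_n(F,\mathcal X)=\inf_{Y\subset\mathcal X,\ \dim Y\le n}\ \max_{u\in F}\ \inf_{v\in Y}\|u-v\|_{\mathcal X}$ ($Y$ linear subspaces). *)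

(* Defs.v *)
From HB Require Import structures.
From mathcomp Require Import all_boot all_order all_algebra.
From mathcomp Require Import all_classical all_reals all_analysis.
Set Implicit Arguments.
Unset Strict Implicit.
Unset Printing Implicit Defensive.
Import Order.TTheory GRing.Theory Num.Theory.
Import numFieldNormedType.Exports.
Local Open Scope classical_set_scope.
Local Open Scope ring_scope.

Definition induced_norm (R : realType) (X : normedModType R)
    (dot : {dot X for idfun}) : Prop :=
  forall x : X, `|x| = Num.sqrt (dot x x).

Definition lin_span (R : realType) (X : lmodType R) (A : set X) : set X :=
  [set x | exists n (c : 'I_n -> R) (v : 'I_n -> X),
     (forall i, A (v i)) /\ x = \sum_i c i *: v i].

(* [V] is a linear subspace of dimension at most [n]. *)
Definition dim_le (R : realType) (X : lmodType R) (V : set X) (n : nat) :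
    Prop :=
  exists v : 'I_n -> X, V = lin_span (range v).

(* The parameter N in {1, 2, ...} u {oo} is an [option nat], with [None] for
   oo; [below N n] means that the (finite) index [n] satisfies n <= N. *)
Definition below (N : option nat) (n : nat) : Prop :=
  if N is Some m then (n <= m)%N else True.

Definition dim_gt (R : realType) (X : lmodType R) (V : set X)
    (N : option nat) : Prop :=
  if N is Some m then ~ dim_le V m else forall m, ~ dim_le V m.

(* The supremum is taken in [R]: it is the operator norm when [f] is a bounded
   linear map and X is not trivial ([sup] is 0 on unbounded or empty sets). *)
Definition op_norm (R : realType) (X Y : normedModType R) (f : X -> Y) : R :=
  sup [set `|f x| / `|x| | x in [set x | x != 0]].

Definition dual (R : realType) (X : normedModType R) :
    set {linear X -> R^o} :=
  [set s | continuous s].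
Arguments dual {R} X.

Definition vanishing (R : realType) (X : normedModType R)
    (S : set {linear X -> R^o}) (F : set X) : Prop :=
  forall x, lin_span F x -> (forall s, S s -> s x = 0) -> x = 0.

Definition closed_values (R : realType) (X : normedModType R)
    (S : set {linear X -> R^o}) (F : set X) : Prop :=
  forall x, lin_span F x -> closed [set (s x : R^o) | s in S].

Record dictionary (R : realType) (X : normedModType R) (F : set X)
    (S : set {linear X -> R^o}) : Prop := {
  dictionary_dual : S `<=` dual X ;
  dictionary_norm : forall s, S s -> op_norm s = 1 ;
  dictionary_vanishing : vanishing S F ;
  dictionary_closed : closed_values S F }.

Definition argmax (R : realType) (T : Type) (A : set T) (f : T -> R) : set T :=
  [set x | A x /\ forall y, A y -> f y <= f x].

(* [sup] is a maximum wherever [maximum] is used below: the sets are compact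
   or have a maximizer, and the functions are continuous. *)
Definition maximum (R : realType) (T : Type) (A : set T) (f : T -> R) : R :=
  sup (f @` A).

Definition geim_space (R : realType) (X : normedModType R) (phi : nat -> X)
    (n : nat) : set X :=
  lin_span (phi @` `I_n).

(* J_n[x], the element of X_n on which sigma_0, ..., sigma_(n-1) take the same
   values as on [x]; the default 0 is only used if there is no such element. *)
Definition geim_interp (R : realType) (X : normedModType R) (phi : nat -> X)
    (sigma : nat -> {linear X -> R^o}) (n : nat) (x : X) : X :=
  xget 0 [set y | geim_space phi n y /\
                  forall i, (i < n)%N -> sigma i y = sigma i x].

Definition lebesgue_constant (R : realType) (X : normedModType R)
    (phi : nat -> X) (sigma : nat -> {linear X -> R^o}) (n : nat) : R :=
  op_norm (geim_interp phi sigma n).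

Record geim_greedy (R : realType) (X : normedModType R) (N : option nat)
    (eta : R) (F : set X) (Sigma : set {linear X -> R^o})
    (Fs : nat -> set X) (Sigmas : nat -> set {linear X -> R^o})
    (phi : nat -> X) (sigma : nat -> {linear X -> R^o}) : Prop := {
  greedy_F_sub : forall n, below N n -> Fs n `<=` F ;
  greedy_F_incr : forall n, below N n.+1 -> Fs n `<=` Fs n.+1 ;
  greedy_Sigma_sub : forall n, below N n -> Sigmas n `<=` Sigma ;
  greedy_Sigma_incr : forall n, below N n.+1 -> Sigmas n `<=` Sigmas n.+1 ;
  greedy_weak : eta < 1 -> forall n, below N n ->
    finite_set (Fs n) /\ finite_set (Sigmas n) ;
  greedy_strong : eta = 1 -> forall n, below N n -> Fs n = F ;
  greedy_vanishing : forall n, below N n -> vanishing (Sigmas n) (Fs n) ;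
  greedy_closed : forall n, below N n -> closed_values (Sigmas n) (Fs n) ;
  greedy_phi0 : argmax (Fs 0%N) (fun x => `|x|) (phi 0%N) ;
  greedy_sigma0 :
    argmax (Sigmas 0%N) (fun s => `|s (phi 0%N)|) (sigma 0%N) ;
  greedy_phi : forall n, (1 <= n)%N -> below N n ->
    argmax (Fs n) (fun x => `|x - geim_interp phi sigma n x|) (phi n) ;
  greedy_sigma : forall n, (1 <= n)%N -> below N n ->
    argmax (Sigmas n)
      (fun s => `|s (phi n - geim_interp phi sigma n (phi n))|) (sigma n) ;
  greedy_max0 :
    eta * maximum F (fun x => `|x|) <= maximum (Fs 0%N) (fun x => `|x|) ;
  greedy_max : forall n, (1 <= n)%N -> below N n ->
    eta * maximum F (fun x => `|x - geim_interp phi sigma n x|)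
    <= maximum (Fs n) (fun x => `|x - geim_interp phi sigma n x|) }.

Definition kolmogorov_width (R : realType) (X : normedModType R) (F : set X)
    (n : nat) : R :=
  inf [set maximum F (fun u => inf [set `|u - v| | v in Y])
      | Y in [set Y | dim_le Y n]].

(* Main.v *)
Require Import Defs.
From HB Require Import structures.
From mathcomp Require Import all_boot all_order all_algebra.
From mathcomp Require Import all_classical all_reals all_analysis.
From mathcomp Require Import ring lra zify.
Set Implicit Arguments.
Unset Strict Implicit.
Unset Printing Implicit Defensive.
Import Order.TTheory GRing.Theory Num.Theory.
Import numFieldNormedType.Exports.
Local Open Scope classical_set_scope.
Local Open Scope ring_scope.

(** The squared distance of x to a span is obtained from the inner product by
    successive rank-one eliminations, and the same eliminations factor a Gram
    determinant into squared distances: for phi_p, ..., phi_(p + 2m - 1),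
    projected off X_p, it is the product of the dist(phi_i, X_i)^2.  If these
    vectors lie within d of an m-dimensional space Y and within r of X_p,
    contracting the components along Y by the factor d / r makes all of them
    O(d) while dividing the determinant by at most (r / d)^(2m); so the
    determinant is at most (2 r d)^(2m).  Since J_n is a quasi-optimal projection
    with constant 1 + Lambda_n, the GEIM is a weak greedy algorithm of parameter
    g_n^-1 = eta / (1 + Lambda_n), and this gives, for n = p + 2m - 1,
    dist(F, X_n)^2 <= 2 g_n^2 d_m dist(F, X_p), from which both rates follow. *)

(** * Positive semidefinite forms and rank-one elimination *)

(** Only semidefiniteness is required: eliminating a vector puts it in the kernel of the form. *)
Definition psd (R : realFieldType) (X : lmodType R) (b : X -> X -> R) : Prop :=
  [/\ forall x y, b x y = b y x,
      forall a x y z, b (a *: x + y) z = a * b x z + b y z &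
      forall x, 0 <= b x x].

Lemma psdD (R : realFieldType) (X : lmodType R) (b c : X -> X -> R) :
  psd b -> psd c -> psd (fun x y => b x y + c x y).
Proof.
move=> [bC bP b0] [cC cP c0]; split=> [x y|a x y z|x]; last exact: addr_ge0.
- by rewrite bC cC.
- by rewrite bP cP; ring.
Qed.

Lemma psdZ (R : realFieldType) (X : lmodType R) (b : X -> X -> R) (k : R) :
  0 <= k -> psd b -> psd (fun x y => k * b x y).
Proof.
move=> k0 [bC bP b0]; split=> [x y|a x y z|x]; last exact: mulr_ge0.
- by rewrite bC.
- by rewrite bP; ring.
Qed.

Lemma psd_rank1 (R : realFieldType) (X : lmodType R) (b : X -> X -> R) (v : X) :
  psd b -> psd (fun x y => b x v * b y v).
Proof.
move=> [bC bP b0]; split=> [x y|a x y z|x]; last by rewrite -expr2 sqr_ge0.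
- by rewrite mulrC.
- by rewrite bP; ring.
Qed.

Lemma psdBB (R : realFieldType) (X : lmodType R) (b : X -> X -> R) (c : R)
    (x v : X) : psd b ->
  b (x - c *: v) (x - c *: v) = b x x - 2 * c * b x v + c ^+ 2 * b v v.
Proof.
move=> [bC bP b0]; have bB y z : b (y - c *: v) z = b y z - c * b v z.
  by rewrite addrC -scaleNr bP mulNr addrC.
by rewrite bB (bC x (_ - _)) (bC v (_ - _)) !bB (bC v x); ring.
Qed.

(** Degenerate Cauchy-Schwarz: the form at [x - c *: v] is affine in [c], and a nonzero slope would
    let it reach -1. *)
Lemma psd_null (R : realFieldType) (X : lmodType R) (b : X -> X -> R) (x v : X) :
  psd b -> b v v = 0 -> b x v = 0.
Proof.
move=> pb bv0; have [bC bP b0] := pb; apply/eqP/negPn/negP => bxv0.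
have := b0 (x - ((b x x + 1) / (2 * b x v)) *: v).
rewrite psdBB // bv0 mulr0 addr0.
have -> : 2 * ((b x x + 1) / (2 * b x v)) * b x v = b x x + 1 by field.
lra.
Qed.

(* For b v v = 0 this is b itself, because x / 0 = 0. *)
Definition residual (R : realFieldType) (X : lmodType R) (b : X -> X -> R)
    (v x y : X) : R := b x y - b x v * b y v / b v v.

Lemma residual_min (R : realFieldType) (X : lmodType R) (b : X -> X -> R)
    (v x : X) : psd b ->
  residual b v x x = b (x - (b x v / b v v) *: v) (x - (b x v / b v v) *: v).
Proof.
move=> pb; rewrite psdBB // /residual; have [->|bv0] := eqVneq (b v v) 0.
  by rewrite invr0 !mulr0; ring.
by field.
Qed.

Lemma psd_residual (R : realFieldType) (X : lmodType R) (b : X -> X -> R)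
    (v : X) : psd b -> psd (residual b v).
Proof.
move=> pb; have [bC bP b0] := pb; split=> [x y|a x y z|x].
- by rewrite /residual bC [b x v * _]mulrC.
- by rewrite /residual !bP; ring.
- by rewrite residual_min.
Qed.

Lemma residual_le (R : realFieldType) (X : lmodType R) (b : X -> X -> R)
    (v x : X) : psd b -> residual b v x x <= b x x.
Proof.
move=> [_ _ b0]; rewrite /residual gerBl.
by rewrite -expr2 mulr_ge0 ?sqr_ge0 ?invr_ge0.
Qed.

Lemma residual_null (R : realFieldType) (X : lmodType R) (b : X -> X -> R)
    (v x : X) : psd b -> b v v = 0 -> forall y, residual b v x y = b x y.
Proof. by move=> pb v0 y; rewrite /residual (psd_null x pb v0) !mul0r subr0. Qed.

Lemma residual_self (R : realFieldType) (X : lmodType R) (b : X -> X -> R)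
    (v x : X) : psd b -> residual b v v x = 0.
Proof.
move=> pb; have [bC _ _] := pb; have [v0|v0] := eqVneq (b v v) 0.
  by rewrite residual_null // bC (psd_null _ pb v0).
by rewrite /residual (bC v x); field.
Qed.

(* [residuals b s x x] is the squared distance, for the seminorm of [b], from
   [x] to the span of [s]. *)
Definition residuals (R : realFieldType) (X : lmodType R) (b : X -> X -> R)
    (s : seq X) : X -> X -> R := foldl (@residual R X) b s.

Lemma psd_residuals (R : realFieldType) (X : lmodType R) (s : seq X)
    (b : X -> X -> R) : psd b -> psd (residuals b s).
Proof. by elim: s b => //= v s IHs b pb; apply/IHs/psd_residual. Qed.

Lemma residuals_le (R : realFieldType) (X : lmodType R) (s : seq X)
    (b : X -> X -> R) (x : X) : psd b -> residuals b s x x <= b x x.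
Proof.
elim: s b => //= v s IHs b pb.
by apply: le_trans (IHs _ (psd_residual v pb)) (residual_le _ _ pb).
Qed.

(** * Spans and the distance to a span *)

Definition subspace (R : realFieldType) (X : lmodType R) (V : set X) : Prop :=
  V 0 /\ forall a x y, V x -> V y -> V (a *: x + y).

Lemma lin_span_min (R : realType) (X : lmodType R) (A V : set X) :
  subspace V -> A `<=` V -> lin_span A `<=` V.
Proof.
move=> [V0 VP] AV _ [n [c [v [Av ->]]]].
apply: (big_ind V) => // [x y Vx Vy|i _]; first by rewrite -[x]scale1r; exact: VP.
by rewrite -[_ *: _]addr0; apply: VP => //; exact/AV.
Qed.

Lemma sub_lin_span (R : realType) (X : lmodType R) (A : set X) :
  A `<=` lin_span A.
Proof.
move=> x Ax; exists 1%N, (fun=> 1), (fun=> x); split=> //.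
by rewrite big_ord1 scale1r.
Qed.

Lemma subspace_lin_span (R : realType) (X : lmodType R) (A : set X) :
  subspace (lin_span A).
Proof.
split=> [|a _ _ [n [c [v [Av ->]]]] [m [d [w [Aw ->]]]]].
  exists 0%N, (fun=> 0), (fun=> 0); split; first by case.
  by rewrite big_ord0.
exists (n + m)%N.
exists (fun i => match fintype.split i with inl j => a * c j | inr j => d j end).
exists (fun i => match fintype.split i with inl j => v j | inr j => w j end).
split=> [i|]; first by case: (fintype.split i).
rewrite big_split_ord /= scaler_sumr; congr (_ + _); apply: eq_bigr => i _.
  by rewrite (unsplitK (inl i)) scalerA.
by rewrite (unsplitK (inr i)).
Qed.

Lemma psd_kernel (R : realFieldType) (X : lmodType R) (b : X -> X -> R) :
  psd b -> subspace [set y | forall x, b y x = 0].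
Proof.
move=> [bC bP _]; split=> [x|a x y bx by0 z] /=.
  have := bP 0 0 0 x; rewrite scale0r addr0 mul0r add0r => _.
  by have := bP (-1) 0 0 x; rewrite scaler0 addr0; lra.
by rewrite bP bx by0 mulr0 addr0.
Qed.

(** Elimination keeps the kernel and adds the eliminated vector to it; the disjunction is the
    induction invariant. *)
Lemma residuals_kernel (R : realFieldType) (X : lmodType R) (s : seq X)
    (b : X -> X -> R) (y : X) :
  psd b -> (y \in s) || `[< forall x, b y x = 0 >] ->
  forall x, residuals b s y x = 0.
Proof.
elim: s b => [|v s IHs] b pb /=; first by move/asboolP.
rewrite in_cons => ysb; apply: IHs; first exact: psd_residual.
case: (boolP (y \in s)) ysb => //= _; rewrite orbF => ysb; apply/asboolP => x.
case/orP: ysb => [/eqP ->|/asboolP by0]; first exact: residual_self.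
by rewrite /residual !by0 !mul0r subr0.
Qed.

(** As [y] is in the kernel of [residuals b s], subtracting it from [x] changes nothing there, and
    elimination only decreases the form. *)
Lemma residuals_lb (R : realType) (X : lmodType R) (s : seq X)
    (b : X -> X -> R) (x y : X) :
  psd b -> lin_span [set` s] y -> residuals b s x x <= b (x - y) (x - y).
Proof.
move=> pb sy; have pbs := psd_residuals s pb.
have by0 : forall z, residuals b s y z = 0.
  apply: (lin_span_min (psd_kernel pbs) _ sy) => v sv z.
  by apply: residuals_kernel; rewrite ?[_ \in _]sv.
have [bC _ _] := pbs.
apply: le_trans (residuals_le s _ pb); rewrite -[in leRHS](scale1r y).
by rewrite psdBB // bC !by0 !mulr0 subr0 addr0.
Qed.

(** The point [y] collects the projections removed by the successive eliminations. The subspace [V]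
    stays fixed while the induction shortens [s]. *)
Lemma residuals_attained (R : realFieldType) (X : lmodType R) (s : seq X)
    (V : set X) (b : X -> X -> R) (x : X) :
  psd b -> subspace V -> (forall v, v \in s -> V v) ->
  exists2 y, V y & residuals b s x x = b (x - y) (x - y).
Proof.
move=> pb [V0 VP]; elim: s b x pb => [|v s IHs] b x pb sV /=.
  by exists 0 => //; rewrite subr0.
have [y Vy ->] := IHs _ x (psd_residual v pb) (fun w ws => sV w (mem_behead (s := v :: s) ws)).
rewrite residual_min // -addrA -opprD; eexists; last reflexivity.
by rewrite addrC; apply: VP => //; apply: sV; rewrite mem_head.
Qed.

(** * Gram determinants *)

(* The Gram determinant of [s], computed by Gaussian elimination. *)
Fixpoint gram_det (R : realFieldType) (X : lmodType R) (b : X -> X -> R)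
    (s : seq X) : R :=
  if s is v :: s' then b v v * gram_det (residual b v) s' else 1.

Lemma gram_det_ge0 (R : realFieldType) (X : lmodType R) (s : seq X)
    (b : X -> X -> R) : psd b -> 0 <= gram_det b s.
Proof.
elim: s b => //= v s IHs b pb; have [_ _ b0] := pb.
by rewrite mulr_ge0 // IHs //; exact: psd_residual.
Qed.

(** Hadamard's inequality: elimination only lowers the later pivots. *)
Lemma gram_det_le (R : realFieldType) (X : lmodType R) (M : R) (s : seq X)
    (b : X -> X -> R) :
  psd b -> (forall v, v \in s -> b v v <= M) -> gram_det b s <= M ^+ size s.
Proof.
elim: s b => //= v s IHs b pb bM; have [_ _ b0] := pb.
have pbv := psd_residual v pb.
rewrite exprS ler_pM ?gram_det_ge0 ?bM ?mem_head // IHs // => w ws.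
by apply: le_trans (residual_le _ _ pb) (bM _ _); rewrite in_cons ws orbT.
Qed.

(* The determinant of B + k f f^T is an affine function of k that is nonnegative
   at k = 0. *)
Lemma gram_det_rank1 (R : realFieldType) (X : lmodType R) (s : seq X)
    (b : X -> X -> R) (f : X -> R) (k l : R) :
  psd b -> 0 < k -> k <= l ->
  k * gram_det (fun x y => b x y + l * (f x * f y)) s
  <= l * gram_det (fun x y => b x y + k * (f x * f y)) s.
Proof.
elim: s b f k l => [|v s IHs] b f k l pb k0 kl /=; first by rewrite !mulr1.
have l0 : 0 < l by exact: lt_le_trans kl.
have [bC _ b0] := pb.
have [bv0|bv0] := eqVneq (b v v) 0.
  have [fv0|fv0] := eqVneq (f v) 0; first by rewrite bv0 fv0 !(mulr0, addr0, mul0r).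
  (* Eliminating a null vector of [b] on which [f] is nonzero removes the rank-one term, whatever
     its weight. *)
  have res m : 0 < m ->
      residual (fun x y => b x y + m * (f x * f y)) v = b.
    move=> m0; apply/funext => x; apply/funext => y; rewrite /residual.
    rewrite !(psd_null _ pb bv0); field.
    by rewrite fv0 gt_eqF //= addr_ge0 //.
  by rewrite !res // bv0 !add0r le_eqVlt; apply/orP; left; apply/eqP; ring.
have {}bv0 : 0 < b v v by rewrite lt_neqAle eq_sym bv0 b0.
(* Eliminating [v] from b + m f f^T leaves the residual of [b] plus a rank-one term along [g]; its
   weight m b(v,v) / (b(v,v) + m f(v)^2) increases with m, so the induction hypothesis applies. *)
pose g x := f x - f v * b x v / b v v.
have den m : 0 < m -> 0 < b v v + m * (f v * f v).
  by move=> m0; rewrite ltr_pwDl // mulr_ge0 ?(ltW m0) // -expr2 sqr_ge0.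
have res m : 0 < m -> residual (fun x y => b x y + m * (f x * f y)) v
    = (fun x y => residual b v x y
         + m * b v v / (b v v + m * (f v * f v)) * (g x * g y)).
  move=> m0; apply/funext => x; apply/funext => y; rewrite /residual /g.
  by field; rewrite !gt_eqF // den.
rewrite !res //.
set k' := k * b v v / _; set l' := l * b v v / _.
have k'0 : 0 < k' by rewrite divr_gt0 ?mulr_gt0 // den.
have kl' : k' <= l'.
  rewrite /k' /l' ler_pdivrMr ?den // mulrAC ler_pdivlMr ?den //.
  have a0 : 0 <= f v * f v by rewrite -expr2 sqr_ge0.
  rewrite !mulrDr; apply: lerD; first by rewrite !ler_pM2r.
  by rewrite le_eqVlt; apply/orP; left; apply/eqP; ring.
have := IHs _ g _ _ (psd_residual v pb) k'0 kl'.
set G := gram_det _ s; set H := gram_det _ s.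
have c0 : 0 < (b v v + k * (f v * f v)) * (b v v + l * (f v * f v)) / b v v.
  by rewrite divr_gt0 ?mulr_gt0 // den.
rewrite -(ler_pM2l c0); congr (_ <= _); rewrite /k' /l'; field.
  by rewrite !gt_eqF // den.
by rewrite !gt_eqF // den.
Qed.

(** Both forms arise from k (b - c) + [residual c v] by adding c(x,v) c(y,v), with weight 1 / c(v,v)
    on the left and k / c(v,v) on the right. *)
Lemma gram_det_residual_mix (R : realFieldType) (X : lmodType R) (s : seq X)
    (b c : X -> X -> R) (v : X) (k : R) :
  psd b -> psd c -> psd (fun x y => b x y - c x y) -> 0 < k -> k <= 1 ->
  k * gram_det (fun x y => k * b x y + (1 - k) * c x y) s
  <= gram_det (fun x y => k * b x y + (1 - k) * residual c v x y) s.
Proof.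
move=> pb pc pbc k0 k1; have [_ _ c0] := pc.
have pmix d : psd d -> psd (fun x y => k * b x y + (1 - k) * d x y).
  by move=> pd; apply: psdD; apply: psdZ; rewrite ?subr_ge0 ?(ltW k0).
have [cv0|cv0] := eqVneq (c v v) 0.
  have -> : residual c v = c.
    by apply/funext => x; apply/funext => y; rewrite residual_null.
  by rewrite ler_piMl // gram_det_ge0 //; exact: pmix.
have {}cv0 : 0 < c v v by rewrite lt_neqAle eq_sym cv0 c0.
have pB := psdD (psdZ (ltW k0) pbc) (psd_residual v pc).
have k'0 : 0 < k / c v v by rewrite divr_gt0.
have kl : k / c v v <= 1 / c v v by rewrite ler_pM2r ?invr_gt0.
have := gram_det_rank1 s (c^~ v) pB k'0 kl.
rewrite ![_ / c v v]mulrC -!mulrA !ler_pM2l ?invr_gt0 // mul1r.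
by congr (_ * gram_det _ s <= gram_det _ s); apply/funext => x;
  apply/funext => y; rewrite /residual; field; rewrite gt_eqF.
Qed.

(** Each vector of [t] costs one factor [k]. The form [c] carries the eliminations already made, and
    [b - c] stays semidefinite. *)
Lemma gram_det_residuals_mix (R : realFieldType) (X : lmodType R)
    (s t : seq X) (b c : X -> X -> R) (k : R) :
  psd b -> psd c -> psd (fun x y => b x y - c x y) -> 0 < k -> k <= 1 ->
  k ^+ size t * gram_det (fun x y => k * b x y + (1 - k) * c x y) s
  <= gram_det (fun x y => k * b x y + (1 - k) * residuals c t x y) s.
Proof.
move=> pb + + k0 k1; elim: t c => [|v t IHt] c pc pbc; first by rewrite mul1r.
apply: le_trans (IHt _ (psd_residual v pc) _); last first.
  have [_ _ c0] := pc.
  have cv0 : 0 <= (c v v)^-1 by rewrite invr_ge0.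
  have := psdD pbc (psdZ cv0 (psd_rank1 v pc)); congr psd.
  by apply/funext => x; apply/funext => y; rewrite /residual; ring.
rewrite exprSr -mulrA ler_wpM2l ?exprn_ge0 ?(ltW k0) //.
exact: gram_det_residual_mix.
Qed.

(* If the vectors of [s] have norm at most [r] and lie within [d] of an
   m-dimensional space, shrinking that space by d / r makes all of them at most
   sqrt 2 * d long, at the cost of a factor (d / r) ^ 2m in the determinant. *)
Lemma gram_det_width (R : realFieldType) (X : lmodType R) (s t : seq X)
    (b : X -> X -> R) (r d : R) :
  psd b -> 0 <= r -> 0 < d -> size s = (2 * size t)%N ->
  (forall v, v \in s -> b v v <= r ^+ 2) ->
  (forall v, v \in s -> residuals b t v v <= d ^+ 2) ->
  gram_det b s <= (2 * r * d) ^+ size s.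
Proof.
(* If r < d, Hadamard's inequality suffices, because r^2 <= 2 r d. *)
move=> pb r0 d0 st sr sd; have [dr|rd] := leP d r; last first.
  apply: le_trans (gram_det_le pb sr) _; apply: lerXn2r.
  - by rewrite nnegrE exprn_ge0.
  - by rewrite nnegrE !mulr_ge0 ?(ltW d0).
  - by rewrite expr2 -mulrA mulrCA ler_wpM2l //; lra.
have {}r0 : 0 < r by exact: lt_le_trans dr.
(* Components along the span of [t] shrink by d / r, their squares by [k]; orthogonal components are
   kept. *)
pose k := (d / r) ^+ 2.
have k0 : 0 < k by rewrite exprn_gt0 // divr_gt0.
have k1 : k <= 1 by rewrite exprn_ile1 ?divr_ge0 ?(ltW d0) ?(ltW r0) // ler_pdivrMr ?mul1r.
have pbb : psd (fun x y => b x y - b x y).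
  have := psdZ (lexx 0) pb; congr psd.
  by apply/funext => x; apply/funext => y; rewrite mul0r subrr.
have pm : psd (fun x y => k * b x y + (1 - k) * residuals b t x y).
  by apply: psdD; apply: psdZ; rewrite ?subr_ge0 ?(ltW k0) //; exact: psd_residuals.
have small v : v \in s ->
    k * b v v + (1 - k) * residuals b t v v <= 2 * d ^+ 2.
  move=> vs; have [_ _ b0] := psd_residuals t pb.
  have kr : k * r ^+ 2 = d ^+ 2 by rewrite /k; field; rewrite gt_eqF.
  have : k * b v v <= d ^+ 2 by rewrite -kr ler_wpM2l ?(ltW k0) ?sr.
  have : (1 - k) * residuals b t v v <= residuals b t v v.
    by rewrite ler_piMl //; lra.
  have := sd v vs; lra.
have := le_trans (gram_det_residuals_mix s t pb pb pbb k0 k1)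
                 (gram_det_le pm small).
have -> : (fun x y => k * b x y + (1 - k) * b x y) = b.
  by apply/funext => x; apply/funext => y; ring.
(* With m = [size t], dividing (2 d^2)^(2m) by k^m = (d / r)^(2m) leaves (2 r d)^(2m). *)
rewrite -ler_pdivlMl; last exact: exprn_gt0.
move=> /le_trans; apply.
rewrite le_eqVlt; apply/orP; left; apply/eqP.
rewrite st !exprM -exprVn -exprMn; congr (_ ^+ _).
by rewrite /k; field; rewrite !gt_eqF.
Qed.

Lemma residuals_mkseqS (R : realFieldType) (X : lmodType R)
    (b : X -> X -> R) (phi : nat -> X) (n : nat) :
  residuals b (mkseq phi n.+1) = residual (residuals b (mkseq phi n)) (phi n).
Proof. by rewrite /residuals mkseqS -cats1 foldl_cat. Qed.

(** Each elimination extends the prefix by one vector, so the pivots are the squared distances of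
    phi_i to X_i. *)
Lemma gram_det_residuals_ge (R : realFieldType) (X : lmodType R)
    (b : X -> X -> R) (phi : nat -> X) (c : R) (p k : nat) : 0 <= c ->
  (forall i, (p <= i < p + k)%N ->
     c <= residuals b (mkseq phi i) (phi i) (phi i)) ->
  c ^+ k <= gram_det (residuals b (mkseq phi p)) (map phi (iota p k)).
Proof.
move=> c0; elim: k p => //= k IHk p cb.
rewrite exprS ler_pM ?exprn_ge0 //; first by apply: cb; lia.
by rewrite -residuals_mkseqS; apply: IHk => i ik; apply: cb; lia.
Qed.

(** * Maxima, operator norms and Kolmogorov widths *)

Lemma argmax_maximum (R : realType) (T : Type) (A : set T) (f : T -> R) (x : T) :
  argmax A f x -> maximum A f = f x.
Proof.
move=> [Ax fx]; have ub : ubound (f @` A) (f x) by move=> _ [y /fx fy <-].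
apply/eqP; rewrite eq_le ge_sup //=; last by exists (f x), x.
by apply: ub_le_sup; [exists (f x)|exists x].
Qed.

Lemma maximum_ub (R : realType) (T : Type) (A : set T) (f : T -> R) (M : R) (x : T) :
  (forall y, A y -> f y <= M) -> A x -> f x <= maximum A f.
Proof.
move=> fM Ax; apply: ub_le_sup; last by exists x.
by exists M => _ [y /fM fy <-].
Qed.

Lemma op_norm_bound (R : realType) (X Y : normedModType R) (f : X -> Y) (C : R)
    (x : X) :
  (forall y, `|f y| <= C * `|y|) -> `|f x| <= op_norm f * `|x|.
Proof.
move=> fC; have [->|x0] := eqVneq x 0.
  by have := fC 0; rewrite normr0 !mulr0.
have x0' : 0 < `|x| by rewrite normr_gt0.
rewrite -ler_pdivrMr //; apply: ub_le_sup; last by exists x.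
by exists C => _ [y y0 <-]; rewrite ler_pdivrMr ?normr_gt0.
Qed.

Lemma op_norm_ge0 (R : realType) (X Y : normedModType R) (f : X -> Y) :
  0 <= op_norm f.
Proof.
rewrite /op_norm; set S := (S in sup S).
have [[[c Sc] ub]|S0] := pselect (has_sup S); last by rewrite sup_out.
apply: le_trans (ub_le_sup ub Sc).
by case: Sc => x _ <-; rewrite divr_ge0.
Qed.

(** Since [sup] is 0 when there is no supremum, a nonzero [op_norm] certifies that the quotients are
    bounded. *)
Lemma op_norm_neq0_bound (R : realType) (X : normedModType R)
    (s : {linear X -> R^o}) (x : X) :
  op_norm s != 0 -> `|s x| <= op_norm s * `|x|.
Proof.
move=> s0; apply: (op_norm_bound (C := op_norm s)) => y.
have [->|y0] := eqVneq y 0; first by rewrite linear0 !normr0 mulr0.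
have y0' : 0 < `|y| by rewrite normr_gt0.
rewrite -ler_pdivrMr //; apply: sup_upper_bound; last by exists y.
by apply: contraPP s0 => /sup_out s0; apply/negP; rewrite negbK; apply/eqP.
Qed.

(** The strict inequality provides near-minimizers for both infima. As 0 lies in [Y], all distances
    are at most 1 and their supremum is genuine. *)
Lemma kolmogorov_width_lt (R : realType) (X : normedModType R) (F : set X)
    (n : nat) (d : R) :
  (forall x, F x -> `|x| <= 1) -> kolmogorov_width F n < d ->
  exists t : seq X, size t = n /\
    forall u, F u -> exists2 y, lin_span [set` t] y & `|u - y| < d.
Proof.
move=> F1 /inf_lt [|_ [Y [v Yv] <-] Yd].
  set Y := lin_span (range (fun _ : 'I_n => (0 : X))).
  by exists (maximum F (fun u => inf [set `|u - v| | v in Y])), Y => //; eexists.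
have [Y0 _] := subspace_lin_span (range v); rewrite -Yv in Y0.
exists [seq v i | i <- enum 'I_n]; rewrite size_map size_enum_ord; split=> // u Fu.
have : inf [set `|u - w| | w in Y] < d.
  apply: le_lt_trans Yd.
  apply: (maximum_ub (f := fun u => inf [set `|u - w| | w in Y]) (M := 1)) Fu => w Fw.
  apply: le_trans (F1 _ Fw); apply: ge_inf; last by exists 0 => //; rewrite subr0.
  by exists 0 => _ [z _ <-].
move=> /inf_lt [|_ [y Yy <-] yd]; first by exists `|u - 0|, 0.
exists y => //; rewrite Yv in Yy; apply: lin_span_min Yy.
  exact: subspace_lin_span.
move=> _ [i _ <-]; apply: sub_lin_span => /=.
by apply: map_f; rewrite mem_enum.
Qed.

(** * The spaces X_n and the interpolation operators *)

Lemma geim_space_sub (R : realType) (X : normedModType R) (phi : nat -> X)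
    (m n : nat) :
  (m <= n)%N -> geim_space phi m `<=` geim_space phi n.
Proof.
move=> mn; apply: lin_span_min; first exact: subspace_lin_span.
by move=> _ [i im <-]; apply: sub_lin_span; exists i => //=; exact: leq_trans im mn.
Qed.

Lemma geim_space_mem (R : realType) (X : normedModType R) (phi : nat -> X)
    (i n : nat) : (i < n)%N -> geim_space phi n (phi i).
Proof. by move=> ni; apply: sub_lin_span; exists i. Qed.

Lemma geim_space0 (R : realType) (X : normedModType R) (phi : nat -> X) (y : X) :
  geim_space phi 0 y -> y = 0.
Proof.
move=> [[|n] [c [v [vI ->]]]]; first by rewrite big_ord0.
by have [i] := vI ord0.
Qed.

Lemma geim_spaceS (R : realType) (X : normedModType R) (phi : nat -> X)
    (n : nat) (y : X) : geim_space phi n.+1 y ->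
  exists c, geim_space phi n (y - c *: phi n).
Proof.
have [V0 VP] := subspace_lin_span (phi @` `I_n).
apply: (lin_span_min (V := [set y | exists c, geim_space phi n (y - c *: phi n)])).
  split; first by exists 0; rewrite scale0r subr0.
  move=> a x z [c xc] [d zd]; exists (a * c + d).
  have := VP a _ _ xc zd; congr geim_space.
  by rewrite scalerBr scalerDl scalerA opprD addrACA.
move=> _ [i + <-]; rewrite /= ltnS leq_eqVlt => /orP[/eqP ->|ni].
  by exists 1; rewrite scale1r subrr.
by exists 0; rewrite scale0r subr0; exact: geim_space_mem.
Qed.

(** Well-posedness of J_n. The bound [C] is included so that the Lebesgue constant is a genuine
    supremum. *)
Record unisolvent (R : realType) (X : normedModType R) (phi : nat -> X)
    (sigma : nat -> {linear X -> R^o}) (n : nat) : Prop := {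
  unisolvent_exists : exists C, forall x, exists y,
    [/\ geim_space phi n y, forall i, (i < n)%N -> sigma i y = sigma i x &
        `|y| <= C * `|x|] ;
  unisolvent_unique : forall y, geim_space phi n y ->
    (forall i, (i < n)%N -> sigma i y = 0) -> y = 0 }.

Lemma geim_interpP (R : realType) (X : normedModType R) (phi : nat -> X)
    (sigma : nat -> {linear X -> R^o}) (n : nat) (x : X) :
  unisolvent phi sigma n ->
  geim_space phi n (geim_interp phi sigma n x) /\
  forall i, (i < n)%N -> sigma i (geim_interp phi sigma n x) = sigma i x.
Proof.
move=> [[C xC] _]; have [y [yn ys _]] := xC x.
rewrite /geim_interp; set P := (P in xget _ P).
by apply: (xgetPex 0 (P := P)); exists y.
Qed.

Lemma geim_interp_unique (R : realType) (X : normedModType R) (phi : nat -> X)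
    (sigma : nat -> {linear X -> R^o}) (n : nat) (x y : X) :
  unisolvent phi sigma n -> geim_space phi n y ->
  (forall i, (i < n)%N -> sigma i y = sigma i x) ->
  geim_interp phi sigma n x = y.
Proof.
move=> un yn ys; have [Jn Js] := geim_interpP x un.
have [_ VP] := subspace_lin_span (phi @` `I_n).
apply/eqP; rewrite -subr_eq0; apply/eqP; apply: (unisolvent_unique un).
  by rewrite addrC -scaleN1r; exact: VP.
by move=> i ni; rewrite linearB Js // ys // subrr.
Qed.

Lemma geim_interpB (R : realType) (X : normedModType R) (phi : nat -> X)
    (sigma : nat -> {linear X -> R^o}) (n : nat) (x y : X) :
  unisolvent phi sigma n -> geim_space phi n y ->
  geim_interp phi sigma n (x - y) = geim_interp phi sigma n x - y.
Proof.
move=> un yn; have [Jn Js] := geim_interpP x un.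
have [_ VP] := subspace_lin_span (phi @` `I_n).
apply: geim_interp_unique => // [|i ni]; last by rewrite !linearB Js.
by rewrite addrC -scaleN1r; exact: VP.
Qed.

Lemma geim_interp_bounded (R : realType) (X : normedModType R) (phi : nat -> X)
    (sigma : nat -> {linear X -> R^o}) (n : nat) :
  unisolvent phi sigma n ->
  exists C, forall x, `|geim_interp phi sigma n x| <= C * `|x|.
Proof.
move=> un; have [C xC] := unisolvent_exists un; exists C => x.
have [y [yn ys yC]] := xC x.
by rewrite (geim_interp_unique un yn ys).
Qed.

(** J_n fixes X_n, so [x] and [x - y] have the same error. *)
Lemma geim_interp_error (R : realType) (X : normedModType R) (phi : nat -> X)
    (sigma : nat -> {linear X -> R^o}) (n : nat) (x y : X) :
  unisolvent phi sigma n -> geim_space phi n y ->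
  `|x - geim_interp phi sigma n x|
  <= (1 + lebesgue_constant phi sigma n) * `|x - y|.
Proof.
move=> un yn; have [C JC] := geim_interp_bounded un.
have := op_norm_bound (x - y) JC; rewrite geim_interpB // => Jxy.
have -> : x - geim_interp phi sigma n x
    = (x - y) - (geim_interp phi sigma n x - y).
  by rewrite opprB addrA subrK.
by rewrite mulrDl mul1r; apply: le_trans (ler_normB _ _) (lerD _ _).
Qed.

Lemma unisolvent0 (R : realType) (X : normedModType R) (phi : nat -> X)
    (sigma : nat -> {linear X -> R^o}) : unisolvent phi sigma 0.
Proof.
split=> [|y /geim_space0 //].
exists 0 => x; exists 0; split=> //; last by rewrite normr0 mul0r.
by have [] := subspace_lin_span (phi @` `I_0).
Qed.

Lemma geim_interp0 (R : realType) (X : normedModType R) (phi : nat -> X)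
    (sigma : nat -> {linear X -> R^o}) (x : X) : geim_interp phi sigma 0 x = 0.
Proof.
have [J0 _] := geim_interpP x (unisolvent0 phi sigma); exact: geim_space0 J0.
Qed.

(** Newton's form of interpolation: the residual r of phi_n is killed by the earlier functionals but
    not by sigma_n, so J_(n+1) x = J_n x + (sigma_n (x - J_n x) / sigma_n r) r. *)
Lemma unisolventS (R : realType) (X : normedModType R) (phi : nat -> X)
    (sigma : nat -> {linear X -> R^o}) (n : nat) :
  unisolvent phi sigma n -> (forall x, `|sigma n x| <= `|x|) ->
  sigma n (phi n - geim_interp phi sigma n (phi n)) != 0 ->
  unisolvent phi sigma n.+1.
Proof.
move=> un sn; have [Jn Js] := geim_interpP (phi n) un.
set r := phi n - _ => sr0.
have [_ VP] := subspace_lin_span (phi @` `I_n).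
have [_ VPS] := subspace_lin_span (phi @` `I_n.+1).
have rn : geim_space phi n.+1 r.
  rewrite /r addrC -scaleN1r; apply: VPS; last exact: geim_space_mem.
  exact: geim_space_sub Jn.
have sr i : (i < n)%N -> sigma i r = 0 by move=> ni; rewrite linearB Js // subrr.
split=> [|y /geim_spaceS [c yc] ys].
  have [C JC] := geim_interp_bounded un.
  exists (C + (1 + C) / `|sigma n r| * `|r|) => x.
  have [xn xs] := geim_interpP x un.
  set z := geim_interp phi sigma n x in xn xs *.
  exists ((sigma n (x - z) / sigma n r) *: r + z); split.
  - by apply: VPS => //; exact: geim_space_sub xn.
  - move=> i; rewrite ltnS leq_eqVlt linearP => /orP[/eqP ->|ni].
      by rewrite linearB /GRing.scale /= divfK // subrK.
    by rewrite (sr i) // scaler0 add0r xs.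
  - apply: le_trans (ler_normD _ _) _; rewrite addrC mulrDl.
    apply: lerD (JC x) _; rewrite normrZ mulrAC ler_wpM2r //.
    rewrite normrM normfV mulrAC ler_wpM2r ?invr_ge0 //.
    apply: le_trans (sn _) _; apply: le_trans (ler_normB _ _) _.
    by rewrite mulrDl mul1r lerD2l JC.
(* The part of [y] in X_n has zero data under the earlier functionals, hence is 0; then sigma_n
   forces [c] to be 0. *)
have cr : y = c *: r + (y - c *: phi n + c *: geim_interp phi sigma n (phi n)).
  by rewrite /r scalerBr addrACA addNr addr0 addrC subrK.
have z0 : y - c *: phi n + c *: geim_interp phi sigma n (phi n) = 0.
  apply: (unisolvent_unique un); first by rewrite addrC; exact: VP.
  move=> i ni; have := ys i (leqW ni).
  by rewrite {1}cr linearP (sr i) // scaler0 add0r.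
rewrite z0 addr0 in cr; have /eqP := ys n (leqnn _).
rewrite {1}cr linearZ mulf_eq0 (negbTE sr0) orbF => /eqP c0.
by rewrite cr c0 scale0r.
Qed.

Lemma belowW (N : option nat) (m n : nat) : (m <= n)%N -> below N n -> below N m.
Proof. by case: N => //= k mn; exact: leq_trans. Qed.

(** Passes from all [d] above a width to the width itself, an infimum that may not be attained. *)
Lemma ler_of_gt (R : realFieldType) (x c k : R) :
  0 <= c -> (forall d, k < d -> x <= c * d) -> x <= c * k.
Proof.
move=> c0 xd; apply/ler_addgt0Pr => e e0; have c1 : 0 < c + 1 by lra.
have := xd (k + e / (c + 1)); rewrite ltrDl divr_gt0 // => /(_ isT).
rewrite mulrDr => /le_trans; apply; rewrite lerD2l mulrCA ler_piMr ?(ltW e0) //.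
by rewrite ler_pdivrMr ?mul1r //; lra.
Qed.

Lemma powR_le_powR (R : realType) (a x y : R) :
  0 <= a -> 0 <= x -> x <= y -> x `^ a <= y `^ a.
Proof.
by move=> a0 x0 xy; apply: ge0_ler_powR; rewrite ?nnegrE // (le_trans x0).
Qed.

(** * Well-posedness of the greedy algorithm *)

Section Greedy.
Context (R : realType) (X : normedModType R)
  (dot : {dot X for idfun}) (hdot : induced_norm dot)
  (F : set X) (hF1 : forall x, F x -> `|x| <= 1)
  (N : option nat) (hdim : dim_gt (lin_span F) N)
  (Sigma : set {linear X -> R^o}) (hSigma : dictionary F Sigma)
  (eta : R) (heta0 : 0 < eta) (heta1 : eta <= 1)
  (Fs : nat -> set X) (Sigmas : nat -> set {linear X -> R^o})
  (phi : nat -> X) (sigma : nat -> {linear X -> R^o})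
  (hgreedy : geim_greedy N eta F Sigma Fs Sigmas phi sigma)
  (hmono : forall m n, (1 <= m)%N -> (m <= n)%N -> below N n ->
     lebesgue_constant phi sigma m <= lebesgue_constant phi sigma n).

Local Notation J := (geim_interp phi sigma).
Local Notation Lambda := (lebesgue_constant phi sigma).

(** With J_0 = 0, the choice of phi_0 and sigma_0 follows the same rule as the later ones. *)
Lemma greedy_interp0E (x : X) : x - J 0 x = x.
Proof. by rewrite geim_interp0 subr0. Qed.

Lemma greedy_argmax (n : nat) :
  below N n -> argmax (Fs n) (fun x => `|x - J n x|) (phi n).
Proof.
case: n => [_|n]; last exact: greedy_phi hgreedy _ _.
by have := greedy_phi0 hgreedy; congr argmax; apply/funext => x;
  rewrite greedy_interp0E.
Qed.

Lemma greedy_argmax_sigma (n : nat) :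
  below N n -> argmax (Sigmas n) (fun s => `|s (phi n - J n (phi n))|) (sigma n).
Proof.
case: n => [_|n]; last exact: greedy_sigma hgreedy _ _.
by rewrite greedy_interp0E; exact: greedy_sigma0 hgreedy.
Qed.

Lemma greedy_maximum (n : nat) : below N n ->
  eta * maximum F (fun x => `|x - J n x|) <= `|phi n - J n (phi n)|.
Proof.
move=> bn; rewrite -(argmax_maximum (greedy_argmax bn)).
case: n bn => [_|n bn]; last exact: (greedy_max hgreedy).
have -> : (fun x => `|x - J 0 x|) = Num.norm.
  by apply/funext => x; rewrite greedy_interp0E.
exact: greedy_max0 hgreedy.
Qed.

Lemma greedy_phiF (n : nat) : below N n -> F (phi n).
Proof.
by move=> bn; apply: (greedy_F_sub hgreedy bn); case: (greedy_argmax bn).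
Qed.

Lemma greedy_phi_sub (i n : nat) : (i <= n)%N -> below N n -> Fs n (phi i).
Proof.
elim: n => [|n IHn]; rewrite leq_eqVlt => /orP[/eqP -> bn|ni bn];
  [by case: (greedy_argmax bn)|by []|by case: (greedy_argmax bn)|].
by apply: (greedy_F_incr hgreedy bn); apply: IHn => //; exact: belowW bn.
Qed.

Lemma greedy_sigma_le (n : nat) (x : X) : below N n -> `|sigma n x| <= `|x|.
Proof.
move=> bn; have sn : op_norm (sigma n) = 1.
  apply: (dictionary_norm hSigma); apply: (greedy_Sigma_sub hgreedy bn).
  by case: (greedy_argmax_sigma bn).
have := op_norm_neq0_bound (s := sigma n) x.
by rewrite sn mul1r; apply; exact: oner_neq0.
Qed.

Lemma greedy_error (n : nat) (u : X) : unisolvent phi sigma n -> below N n ->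
  F u -> eta * `|u - J n u| <= `|phi n - J n (phi n)|.
Proof.
move=> un bn Fu; apply: le_trans (greedy_maximum bn).
rewrite ler_pM2l //; have [C JC] := geim_interp_bounded un.
apply: (maximum_ub (f := fun x => `|x - J n x|) (M := 1 + `|C|)) Fu => y Fy.
apply: le_trans (ler_normB _ _) _; apply: lerD; first exact: hF1.
apply: le_trans (JC y) _; apply: le_trans (ler_wpM2r _ (ler_norm C)) _ => //.
by rewrite ler_piMr // hF1.
Qed.

Lemma not_sub_geim_space (n : nat) : below N n -> ~ (F `<=` geim_space phi n).
Proof.
move=> bn Fn.
have dimF m : (n <= m)%N -> dim_le (lin_span F) m.
  (* Zeros pad phi_0, ..., phi_(n-1) to length [m], since a finite [N] may exceed [n]. *)
  move=> nm; exists (fun i : 'I_m => if (i < n)%N then phi i else 0).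
  apply/seteqP; split.
    apply: (lin_span_min (subspace_lin_span _)) => u /Fn.
    apply: (lin_span_min (subspace_lin_span _)) => v [i ni <-].
    apply: sub_lin_span; exists (Ordinal (leq_trans ni nm)) => //=.
    by move: ni => /= ->.
  apply: (lin_span_min (subspace_lin_span _)) => u [i _ <-]; case: ifP => ni.
    by apply: sub_lin_span; apply: greedy_phiF; apply: belowW bn; exact: ltnW.
  by have [] := subspace_lin_span F.
case: N bn hdim => [m|] /= bn; first by apply; exact: dimF.
by move/(_ n); apply; exact: dimF.
Qed.

Lemma greedy_residual_neq0 (n : nat) : unisolvent phi sigma n -> below N n ->
  phi n - J n (phi n) != 0.
Proof.
move=> un bn; apply/eqP => r0; apply: (not_sub_geim_space bn) => u Fu.
have := greedy_error un bn Fu; rewrite r0 normr0 pmulr_rle0 // normr_le0 subr_eq0.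
by move=> /eqP ->; have [] := geim_interpP u un.
Qed.

(** If sigma_n vanished on the residual of phi_n, so would all of [Sigmas n] by maximality; the
    residual lies in the span of [Fs n], so (P2) would make it 0, against the dimension of span
    F. *)
Lemma greedy_unisolvent (n : nat) : below N n -> unisolvent phi sigma n.
Proof.
elim: n => [_|n IHn bSn]; first exact: unisolvent0.
have bn : below N n by exact: belowW bSn.
have un := IHn bn; apply: unisolventS => // [x|]; first exact: greedy_sigma_le.
apply: contra_neq (greedy_residual_neq0 un bn) => s0.
apply: (greedy_vanishing hgreedy bn); last first.
  move=> s Ss; have [_ /(_ s Ss)] := greedy_argmax_sigma bn.
  by rewrite s0 normr0 normr_le0 => /eqP.
have [_ VP] := subspace_lin_span (Fs n).
rewrite addrC -scaleN1r; apply: VP; last first.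
  by apply: sub_lin_span; exact: greedy_phi_sub.
have [Jn _] := geim_interpP (phi n) un; apply: lin_span_min Jn.
  exact: subspace_lin_span.
by move=> _ [i ni <-]; apply: sub_lin_span; apply: greedy_phi_sub => //; exact: ltnW.
Qed.

(** * Distances to X_n and the weak greedy property *)

Lemma psd_dot : psd dot.
Proof.
split=> [x y|a x y z|x].
- by rewrite hermC expr0 mul1r.
- by rewrite linearPl.
- have [->|x0] := eqVneq x 0; first by rewrite linear0l.
  exact/ltW/neq0_dnorm_gt0.
Qed.

Lemma dot_norm (x : X) : dot x x = `|x| ^+ 2.
Proof. by rewrite hdot sqr_sqrtr //; have [_ _] := psd_dot. Qed.

Definition dist (n : nat) (x : X) : R :=
  Num.sqrt (residuals dot (mkseq phi n) x x).

Lemma dist_ge0 (n : nat) (x : X) : 0 <= dist n x.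
Proof. exact: sqrtr_ge0. Qed.

Lemma sqr_dist (n : nat) (x : X) :
  dist n x ^+ 2 = residuals dot (mkseq phi n) x x.
Proof. by rewrite sqr_sqrtr //; have [_ _] := psd_residuals (mkseq phi n) psd_dot. Qed.

Lemma dist_lb (n : nat) (x y : X) : geim_space phi n y -> dist n x <= `|x - y|.
Proof.
move=> yn; rewrite hdot; apply: ler_wsqrtr; apply: (residuals_lb x psd_dot).
apply: (lin_span_min (subspace_lin_span _)) yn => _ [i ni <-].
by apply: sub_lin_span => /=; apply: map_f; rewrite mem_iota.
Qed.

Lemma dist_attained (n : nat) (x : X) :
  exists2 y, geim_space phi n y & dist n x = `|x - y|.
Proof.
have [v /mapP [i ni ->]|y yn xy] := residuals_attained (s := mkseq phi n) x psd_dot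
    (subspace_lin_span (phi @` `I_n)).
  by apply: geim_space_mem; move: ni; rewrite mem_iota.
by exists y => //; rewrite /dist xy hdot.
Qed.

Lemma dist_le_norm (n : nat) (x : X) : dist n x <= `|x|.
Proof.
have [V0 _] := subspace_lin_span (phi @` `I_n).
by have := dist_lb x V0; rewrite subr0.
Qed.

Lemma dist_anti (m n : nat) (x : X) : (m <= n)%N -> dist n x <= dist m x.
Proof.
move=> mn; have [y ym ->] := dist_attained m x.
by apply: dist_lb; exact: geim_space_sub ym.
Qed.

Lemma interp_error_dist (n : nat) (x : X) : below N n ->
  `|x - J n x| <= (1 + Lambda n) * dist n x.
Proof.
move=> bn; have [y yn ->] := dist_attained n x.
by apply: geim_interp_error yn; exact: greedy_unisolvent.
Qed.

(** The factor g_n, inverse of the weak greedy parameter. *)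
Definition stability (n : nat) : R := (1 + Lambda n) / eta.

Lemma stability_ge1 (n : nat) : 1 <= stability n.
Proof.
by rewrite ler_pdivlMr // mul1r (le_trans heta1) // lerDl op_norm_ge0.
Qed.

Lemma stability_geV (n : nat) : eta^-1 <= stability n.
Proof. by rewrite ler_peMl ?invr_ge0 ?(ltW heta0) // lerDl op_norm_ge0. Qed.

Lemma stability_le (m n : nat) : (1 <= m)%N -> (m <= n)%N -> below N n ->
  stability m <= stability n.
Proof. by move=> m1 mn bn; rewrite ler_pM2r ?invr_gt0 // lerD2l hmono. Qed.

(** The distance is at most the interpolation error, which the greedy choice compares with that of
    phi_n; quasi-optimality leads back to a distance. *)
Lemma dist_greedy (n : nat) (u : X) : below N n -> F u ->
  dist n u <= stability n * dist n (phi n).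
Proof.
move=> bn Fu; have un := greedy_unisolvent bn.
rewrite /stability mulrAC ler_pdivlMr // mulrC.
apply: le_trans (interp_error_dist _ bn); apply: le_trans (greedy_error un bn Fu).
by rewrite ler_pM2l // dist_lb //; have [] := geim_interpP u un.
Qed.

(** * Comparison with the widths, and decay rates *)

(** Projecting off X_p does not increase distances, so a space close to F in norm stays close for
    the projected form. *)
Lemma gram_det_kolmogorov (p m : nat) (r d : R) (s : seq X) :
  0 <= r -> (forall u, F u -> dist p u <= r) ->
  0 < d -> kolmogorov_width F m < d ->
  size s = (2 * m)%N -> (forall v, v \in s -> F v) ->
  gram_det (residuals dot (mkseq phi p)) s <= (2 * r * d) ^+ (2 * m).
Proof.
move=> r0 Fr d0 Fd sm sF; have [t [tm Ft]] := kolmogorov_width_lt hF1 Fd.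
rewrite -sm; apply: (gram_det_width (t := t)) => //; rewrite ?tm //.
- exact: psd_residuals psd_dot.
- by move=> v /sF /Fr vr; rewrite -sqr_dist lerXn2r ?nnegrE ?dist_ge0.
- move=> v /sF /Ft [y ty vy].
  apply: le_trans (residuals_lb v (psd_residuals _ psd_dot) ty) _.
  apply: le_trans (residuals_le _ _ psd_dot) _.
  by rewrite dot_norm lerXn2r ?nnegrE ?(ltW d0) ?(ltW vy).
Qed.

(** Covers n = 1, as [dist_step] starts at n = 2. The determinant is that of phi_0 and [u], with p =
    0 and m = 1; its pivot |phi_0|^2 cancels against r = |phi_0| / eta. *)
Lemma dist1_le (e : R) (u : X) : below N 0 -> 0 <= e ->
  kolmogorov_width F 1 <= e -> F u -> dist 1 u <= 2 / eta * e.
Proof.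
move=> b0 e0 Fe Fu; apply: ler_of_gt => [|d ed].
  by rewrite divr_ge0 ?(ltW heta0).
have phi0 : 0 < `|phi 0%N|.
  have := greedy_residual_neq0 (unisolvent0 phi sigma) b0.
  by rewrite greedy_interp0E normr_gt0.
have F0 v : F v -> dist 0 v <= `|phi 0%N| / eta.
  move=> Fv; apply: le_trans (dist_le_norm 0 v) _; rewrite ler_pdivlMr // mulrC.
  by have := greedy_error (unisolvent0 phi sigma) b0 Fv; rewrite !greedy_interp0E.
have r0 : 0 <= `|phi 0%N| / eta by rewrite divr_ge0 ?(ltW heta0).
have := gram_det_kolmogorov (m := 1) (s := [:: phi 0%N; u]) r0 F0
  (le_lt_trans e0 ed) (le_lt_trans Fe ed) erefl.
rewrite [gram_det _ _]/= mulr1 dot_norm.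
have -> : residual dot (phi 0%N) u u = dist 1 u ^+ 2 by rewrite sqr_dist.
rewrite -exprMn ler_pXn2r ?nnegrE ?mulr_ge0 ?dist_ge0 ?invr_ge0 ?(ltW heta0)
  ?(le_trans e0 (ltW ed)) //.
have -> : 2 * (`|phi 0%N| / eta) * d = `|phi 0%N| * (2 / eta * d) by ring.
rewrite ler_pM2l //; apply => v; rewrite !inE => /orP[] /eqP -> //.
exact: greedy_phiF.
Qed.

(** The vectors phi_p, ..., phi_n give 2m pivots, and a 2m-th root of the determinant bound is
    taken. Here p > 0 because Lambda is monotone only from index 1 on. *)
Lemma dist_step (p m n : nat) (r e : R) (u : X) :
  (0 < p)%N -> (0 < m)%N -> n.+1 = (p + 2 * m)%N -> below N n ->
  0 <= r -> (forall v, F v -> dist p v <= r) ->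
  0 <= e -> kolmogorov_width F m <= e -> F u ->
  dist n u ^+ 2 <= 2 * stability n ^+ 2 * r * e.
Proof.
move=> p0 m0 npm bn r0 Fr e0 Fe Fu.
have g0 : 0 < stability n by exact: lt_le_trans (stability_ge1 n).
apply: ler_of_gt => [|d ed]; first by rewrite mulr_ge0 // mulr_ge0 // sqr_ge0.
have sF v : v \in map phi (iota p (2 * m)) -> F v.
  move=> /mapP [i]; rewrite mem_iota => ni ->; apply: greedy_phiF.
  by apply: belowW bn; lia.
have := gram_det_kolmogorov r0 Fr (le_lt_trans e0 ed) (le_lt_trans Fe ed) _ sF.
rewrite size_map size_iota => /(_ erefl).
(* Up to n, distances to X_i decrease and g_i increases, so every pivot is bounded below by its
   value at n. *)
have low i : (p <= i < p + 2 * m)%N ->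
    (dist n u / stability n) ^+ 2 <= residuals dot (mkseq phi i) (phi i) (phi i).
  move=> ni; have ni' : (i <= n)%N by lia.
  have bi := belowW ni' bn.
  rewrite -sqr_dist lerXn2r ?nnegrE ?dist_ge0 //.
    by rewrite divr_ge0 ?dist_ge0 ?(ltW g0).
  rewrite ler_pdivrMr //; apply: le_trans (dist_anti u ni') _.
  apply: le_trans (dist_greedy bi Fu) _; rewrite mulrC.
  by rewrite ler_wpM2l ?dist_ge0 // stability_le //; lia.
move=> /(le_trans (gram_det_residuals_ge (sqr_ge0 _) low)).
have m2 : (0 < 2 * m)%N by rewrite muln_gt0.
have rd0 : 0 <= 2 * r * d by rewrite !mulr_ge0 // (le_trans e0 (ltW ed)).
rewrite (ler_pXn2r m2) ?nnegrE ?sqr_ge0 //.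
rewrite expr_div_n ler_pdivrMr ?exprn_gt0 //.
by have -> : 2 * stability n ^+ 2 * r * d = 2 * r * d * stability n ^+ 2 by ring.
Qed.

(* The indices of [dist_step] for n >= 2 are m = ceil (n / 4) and
   p = n + 1 - 2 m, about n / 2: then n ^ 2 <= 8 p m. *)
Lemma dist_polynomial (C0 alpha : R)
    (hC0 : 0 < C0) (halpha : 0 < alpha) :
  (forall n, (1 <= n)%N -> kolmogorov_width F n <= C0 * n%:R `^ (- alpha)) ->
  forall n u, (1 <= n)%N -> below N n -> F u ->
  dist n u
  <= C0 * 2 `^ (3 * alpha + 1) * stability n ^+ 2 * n%:R `^ (- alpha).
Proof.
move=> Fd n.
have KE : 2 `^ (3 * alpha + 1) = 2 * 8 `^ alpha :> R.
  rewrite powRD; last by rewrite pnatr_eq0 implybT.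
  rewrite powRr1 // powRrM mulrC; congr (_ * _ `^ _).
  by rewrite (powR_mulrn 3) //; ring.
have E1 : 1 <= 8 `^ alpha :> R.
  have e8 : 1 <= 8 :> R by lra.
  by have := ler_powR e8 (ltW halpha); rewrite powRr0.
rewrite KE; elim/ltn_ind: n => n IHn u n1 bn Fu.
have g1 := stability_ge1 n.
have gV := stability_geV n.
set g := stability n in g1 gV *.
have [n2|] := ltnP 1 n; last first.
  (* For n = 1 the claim follows from eta^-1 <= g <= g^2 <= 8^alpha g^2. *)
  move=> n1'; have {n1 n1'} nE : n = 1%N by lia.
  have := dist1_le (e := C0) (u := u).
  have := Fd 1%N isT; rewrite nE powR1 !mulr1 => Fd1 /(_ _ (ltW hC0) Fd1 Fu) D1.
  apply: le_trans (D1 _) _; first exact: belowW bn.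
  have -> : 2 / eta * C0 = 2 * C0 * eta^-1 by ring.
  have -> : C0 * (2 * 8 `^ alpha) * g ^+ 2 = 2 * C0 * (8 `^ alpha * g ^+ 2) by ring.
  rewrite ler_pM2l ?mulr_gt0 //; apply: le_trans gV _.
  apply: (@le_trans _ _ (g ^+ 2)); first by rewrite expr2 ler_peMl // (le_trans ler01 g1).
  by rewrite ler_peMl ?sqr_ge0.
pose m := ((n + 3) %/ 4)%N; pose p := (n.+1 - 2 * m)%N.
have m0 : (0 < m)%N by rewrite /m; lia.
have p0 : (0 < p)%N by rewrite /p /m; lia.
have pn : (p < n)%N by rewrite /p /m; lia.
have npm : n.+1 = (p + 2 * m)%N by rewrite /p /m; lia.
have nnpm : (n * n <= 8 * (p * m))%N by rewrite /p /m; nia.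
have pow0 k : (0 < k)%N -> 0 < (k%:R : R) `^ alpha.
  by move=> k0; rewrite powR_gt0 // ltr0n.
have nnpmR : n%:R `^ alpha * n%:R `^ alpha
    <= 8 `^ alpha * (p%:R `^ alpha * m%:R `^ alpha) :> R.
  by rewrite -!powRM // -?natrM; apply: powR_le_powR; rewrite ?ler_nat // ltW.
have bp : below N p by apply: belowW bn; exact: ltnW.
have Fp v : F v -> dist p v <= C0 * (2 * 8 `^ alpha) * g ^+ 2 * p%:R `^ (- alpha).
  move=> Fv; apply: le_trans (IHn p pn v p0 bp Fv) _.
  rewrite ler_wpM2r ?powR_ge0 // ler_wpM2l ?mulr_ge0 ?powR_ge0 ?(ltW hC0) //.
  rewrite lerXn2r ?nnegrE ?(le_trans ler01 g1) //.
    exact: le_trans (stability_ge1 _).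
  by apply: (stability_le) => //; exact: ltnW.
have e0 : 0 <= C0 * m%:R `^ (- alpha) by rewrite mulr_ge0 ?powR_ge0 ?(ltW hC0).
have r0 := le_trans (dist_ge0 _ _) (Fp u Fu).
have := dist_step p0 m0 npm bn r0 Fp e0 (Fd m m0) Fu.
rewrite -/g !powRN => D2; clearbody g.
have h0 : 0 <= C0 * (2 * 8 `^ alpha) * g ^+ 2 * (n%:R `^ alpha)^-1.
  by rewrite !mulr_ge0 ?invr_ge0 ?exprn_ge0 ?powR_ge0 ?(ltW hC0) ?(le_trans ler01 g1).
rewrite -(ler_pXn2r (n := 2)) ?nnegrE ?dist_ge0 //.
apply: le_trans D2 _.
move: (pow0 n n1) (pow0 p p0) (pow0 m m0) nnpmR E1.
set A := _ `^ _; set B := _ `^ _; set M := _ `^ _; set E := _ `^ _.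
move=> A0 B0 M0 AB E1.
(* Both sides share the factor 4 C0^2 g^4 8^alpha; what remains is (p m)^(-alpha) <= 8^alpha n^(-2
   alpha). *)
have -> : 2 * g ^+ 2 * (C0 * (2 * E) * g ^+ 2 / B) * (C0 / M)
  = (4 * C0 ^+ 2 * g ^+ 4 * E) * (B * M)^-1 by field; rewrite !gt_eqF.
have -> : (C0 * (2 * E) * g ^+ 2 / A) ^+ 2
  = (4 * C0 ^+ 2 * g ^+ 4 * E) * (E / (A * A)) by field; rewrite !gt_eqF.
rewrite ler_wpM2l //.
  by rewrite !mulr_ge0 ?exprn_ge0 ?(ltW hC0) ?(le_trans ler01 g1) ?(le_trans ler01 E1).
by rewrite ler_pdivlMr ?mulr_gt0 // ler_pdivrMl ?mulr_gt0 // [leRHS]mulrC.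
Qed.

(** One use of [dist_step] with r = 1 suffices: m = floor (n / 2) and p is 1 or 2. Since n <= 4 m,
    m^alpha >= n^alpha / 4^alpha; the square root halves the exponent, which gives c1 2^(-2 alpha -
    1). *)
Lemma dist_exponential (C0 alpha c1 : R)
    (hC0 : 1 <= C0) (halpha : 0 < alpha) (hc1 : 0 < c1) :
  (forall n, (1 <= n)%N ->
     kolmogorov_width F n <= C0 * expR (- c1 * n%:R `^ alpha)) ->
  forall n u, (1 < n)%N -> below N n -> F u ->
  dist n u <= C0 * Num.sqrt 2 * stability n
    * expR (- (c1 * 2 `^ (- 2 * alpha - 1)) * n%:R `^ alpha).
Proof.
move=> Fd n u n1 bn Fu.
have g1 := stability_ge1 n.
set g := stability n in g1 *.
pose m := (n %/ 2)%N; pose p := (n.+1 - 2 * m)%N.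
have m0 : (0 < m)%N by rewrite /m; lia.
have p0 : (0 < p)%N by rewrite /p /m; lia.
have npm : n.+1 = (p + 2 * m)%N by rewrite /p /m; lia.
have nm : (n <= 4 * m)%N by rewrite /m; lia.
have C00 : 0 < C0 by exact: lt_le_trans hC0.
have Fp v : F v -> dist p v <= 1.
  by move=> Fv; apply: le_trans (hF1 Fv); exact: dist_le_norm.
have e0 : 0 <= C0 * expR (- c1 * m%:R `^ alpha) by rewrite mulr_ge0 ?expR_ge0 ?ltW.
have := dist_step p0 m0 npm bn ler01 Fp e0 (Fd m m0) Fu.
rewrite -/g mulr1 => D2; clearbody g.
rewrite -(ler_pXn2r (n := 2)) ?nnegrE ?dist_ge0 //; last first.
  by rewrite !mulr_ge0 ?expR_ge0 ?sqrtr_ge0 ?(ltW C00) ?(le_trans ler01 g1).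
apply: le_trans D2 _.
rewrite !exprMn sqr_sqrtr // -expRM_natl.
set a := expR _; set b := expR _; suff ab : a <= b.
  have -> : 2 * g ^+ 2 * (C0 * a) = C0 * 2 * g ^+ 2 * a by ring.
  have -> : C0 ^+ 2 * 2 * g ^+ 2 * b = C0 * 2 * g ^+ 2 * (C0 * b) by ring.
  rewrite ler_wpM2l ?mulr_ge0 ?exprn_ge0 ?(ltW C00) ?(le_trans ler01 g1) //.
  (* Here [1 <= C0] enters, as C0 <= C0^2. *)
  by apply: le_trans ab _; rewrite ler_peMl ?expR_ge0.
rewrite ler_expR.
have nmR : n%:R `^ alpha <= 4 `^ alpha * m%:R `^ alpha :> R.
  by rewrite -powRM // -natrM; apply: powR_le_powR; rewrite ?ler_nat // ltW.
have f0 : 0 < 4 `^ alpha :> R by rewrite powR_gt0.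
have -> : 2 `^ (- 2 * alpha - 1) = (2 * 4 `^ alpha)^-1 :> R.
  have -> : - 2 * alpha - 1 = - (2 * alpha + 1) by ring.
  rewrite powRN powRD; last by rewrite pnatr_eq0 implybT.
  rewrite powRr1 // powRrM mulrC (powR_mulrn 2) //.
  by congr (2 * _ `^ _)^-1; ring.
have -> : 2%:R * (- (c1 / (2 * 4 `^ alpha)) * n%:R `^ alpha)
  = - (c1 * (n%:R `^ alpha / 4 `^ alpha)) by field; rewrite gt_eqF.
by rewrite mulNr lerN2 ler_pM2l // ler_pdivrMr // mulrC.
Qed.

End Greedy.

Theorem corollary5p10 (R : realType) (X : completeNormedModType R)
    (dot : {dot X for idfun}) (hdot : induced_norm dot)
    (F : set X) (hF : compact F) (hF1 : forall x, F x -> `|x| <= 1)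
    (N : option nat) (hN : below N 1) (hdim : dim_gt (lin_span F) N)
    (Sigma : set {linear X -> R^o}) (hSigma : dictionary F Sigma)
    (eta : R) (heta0 : 0 < eta) (heta1 : eta <= 1)
    (Fs : nat -> set X) (Sigmas : nat -> set {linear X -> R^o})
    (phi : nat -> X) (sigma : nat -> {linear X -> R^o})
    (hgreedy : geim_greedy N eta F Sigma Fs Sigmas phi sigma)
    (C0 alpha c1 : R) (hC0 : 0 < C0) (halpha : 0 < alpha) (hc1 : 0 < c1)
    (hmono : forall m n, (1 <= m)%N -> (m <= n)%N -> below N n ->
       lebesgue_constant phi sigma m <= lebesgue_constant phi sigma n) :
  let J := geim_interp phi sigma in
  let Lambda := lebesgue_constant phi sigma in
  let d := kolmogorov_width F in
  ((forall n, (1 <= n)%N -> d n <= C0 * n%:R `^ (- alpha)) ->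
   forall x n, F x -> (1 <= n)%N -> below N n ->
     `|x - J n x| <=
       if n == 1%N then 2 * C0 * (1 + eta^-1) * (1 + Lambda 1%N)
       else C0 * 2 `^ (3 * alpha + 1) * (1 + Lambda n) ^+ 3
              * eta ^- 2 * n%:R `^ (- alpha))
  /\
  (1 <= C0 ->
   (forall n, (1 <= n)%N -> d n <= C0 * expR (- c1 * n%:R `^ alpha)) ->
   let c2 := c1 * 2 `^ (- 2 * alpha - 1) in
   forall x n, F x -> (1 <= n)%N -> below N n ->
     `|x - J n x| <=
       if n == 1%N then 2 * C0 * (1 + eta^-1) * (1 + Lambda 1%N)
       else C0 * Num.sqrt 2 * (1 + Lambda n) ^+ 2
              * eta^-1 * expR (- c2 * n%:R `^ alpha)).
Proof.
move=> J Lambda d.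
have L0 n : 0 <= 1 + Lambda n by rewrite addr_ge0 ?op_norm_ge0.
have err n x : below N n -> `|x - J n x| <= (1 + Lambda n) * dist dot phi n x.
  exact: (interp_error_dist hdot hF1 hdim hSigma heta0 hgreedy).
(* Both decay hypotheses give d_1 <= C0, so n = 1 is treated once; 2 C0 / eta is enlarged to 2 C0 (1
   + 1 / eta). *)
have err1 x : d 1%N <= C0 -> F x -> below N 1 ->
    `|x - J 1%N x| <= 2 * C0 * (1 + eta^-1) * (1 + Lambda 1%N).
  move=> d1 Fx b1; apply: le_trans (err 1%N x b1) _.
  rewrite mulrC ler_wpM2r //.
  have b0 : below N 0 by exact: belowW b1.
  have := dist1_le hdot hF1 hdim heta0 hgreedy b0 (ltW hC0) d1 Fx.
  move=> /le_trans; apply; rewrite mulrDr mulr1 mulrAC lerDr mulr_ge0 //; exact: ltW.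
split=> [dn x n Fx n1 bn|C01 dn c2 x n Fx n1 bn]; case: eqP => [nE|/eqP nE].
- by subst n; apply: err1 => //; have := dn 1%N isT; rewrite powR1 mulr1.
- apply: le_trans (err n x bn) _.
  have := dist_polynomial hdot hF1 hdim hSigma heta0 heta1 hgreedy hmono
    hC0 halpha dn n1 bn Fx.
  move=> /(ler_wpM2l (L0 n)) /le_trans; apply.
  rewrite le_eqVlt; apply/orP; left; apply/eqP.
  by rewrite /stability -/Lambda; field; rewrite gt_eqF.
- subst n; apply: err1 => //; apply: le_trans (dn 1%N isT) _.
  rewrite ler_piMr ?(ltW hC0) // -expR0 ler_expR mulNr oppr_le0.
  by rewrite mulr_ge0 ?powR_ge0 ?ltW.
- have n2 : (1 < n)%N by rewrite ltn_neqAle eq_sym nE.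
  apply: le_trans (err n x bn) _.
  have := dist_exponential hdot hF1 hdim hSigma heta0 heta1 hgreedy hmono
    C01 halpha hc1 dn n2 bn Fx.
  move=> /(ler_wpM2l (L0 n)) /le_trans; apply.
  rewrite le_eqVlt; apply/orP; left; apply/eqP.
  by rewrite /stability -/Lambda; field; rewrite gt_eqF.
Qed.
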